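(* Let $p$ be a prime number, $k,n\in\mathbb{Z}_{>0}$, $m=(m_1,\dots,m_n)\in\mathbb{Z}_{>0}^n$, and $p>|m|=m_1+\dots+m_n$. Let $z^0=(z^0_1,\dots,z^0_n)\in\mathbb{F}_p^n$ have distinct coordinates, and let $t^0=(t^0_1,\dots,t^0_k)\in\mathbb{F}_p^k$ be a solution of the Bethe ansatz equations $$\sum_{j\ne i}\frac{2}{t_i-t_j}-\sum_{s=1}^n\frac{m_s}{t_i-z_s^0}=0,\qquad i=1,\dots,k .$$ Then the vector $W_{k,n,m}(t^0,z^0)$ is well-defined and lies in the subspace $\operatorname{Sing}L^{\otimes m}[|m|-2k]$; that is, for every $J=(j_1,\dots,j_n)\in\mathcal{I}_{k-1}$, $$\sum_{s=1}^n (j_s+1)(m_s-j_s)\,W_{J+\mathbf{1}_s}(t^0,z^0)=0 .$$ Moreover, the vector $W_{k,n,m}(t^0,z^0)$ satisfies $$H_s(z^0).W_{k,n,m}(t^0,z^0)=\lambda_s(t^0,z^0)\,W_{k,n,m}(t^0,z^0),\qquad s=1,\dots,n,$$ where $$\lambda_s(t^0,z^0)=\sum_{l\ne s}\frac{m_sm_l/2}{z^0_s-z^0_l}-\sum_{i=1}^k\frac{m_s}{z^0_s-t^0_i}\in\mathbb{F}_p .$$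
   Context: The Lie algebra $\mathfrak{sl}_2$ is considered over $\mathbb{F}_p$, with basis $e,f,h$ and $[e,f]=h$, $[h,e]=2e$, $[h,f]=-2f$. A solution of the Bethe ansatz equations is a $t^0$ for which all denominators are nonzero (so $t^0_1,\dots,t^0_k,z^0_1,\dots,z^0_n$ are pairwise distinct) and all equations hold. For an integer $i\ge 0$, $L_i$ is the $\mathfrak{sl}_2$-module over $\mathbb{F}_p$ with basis $v_i,fv_i,\dots,f^iv_i$ and action $h.f^kv_i=(i-2k)f^kv_i$; $f.f^kv_i=f^{k+1}v_i$ for $k<i$, $f.f^iv_i=0$; $e.v_i=0$, $e.f^kv_i=k(i-k+1)f^{k-1}v_i$ for $k\ge1$. Put $L^{\otimes m}=L_{m_1}\otimes\dots\otimes L_{m_n}$ (tensor product of $\mathfrak{sl}_2$-modules). For $J=(j_1,\dots,j_n)\in\mathbb{Z}_{\ge0}^n$ with $j_s\le m_s$ put $f_Jv_m=f^{j_1}v_{m_1}\otimes\dots\otimes f^{j_n}v_{m_n}$; these vectors form a basis of $L^{\otimes m}$. Put $|J|=j_1+\dots+j_n$ and $\mathcal{I}_k=\{J\in\mathbb{Z}_{\ge0}^n : |J|=k,\ j_s\le m_s \text{ for all } s\}$. $\mathbf{1}_s$ is the $s$-th standard basis vector of $\mathbb{Z}^n$. For $\lambda\in\mathbb{Z}$, $L^{\otimes m}[\lambda]=\{v\in L^{\otimes m} : h.v=\lambda v\}$ and $\operatorname{Sing}L^{\otimes m}[\lambda]=\{v\in L^{\otimes m}[\lambda] : e.v=0\}$.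 The Casimir element is $\Omega=e\otimes f+f\otimes e+\frac12 h\otimes h$; $\Omega^{(i,j)}=\Omega^{(j,i)}$ denotes the operator on $L^{\otimes m}$ acting as $\Omega$ in the $i$-th and $j$-th tensor factors and as the identity in the other factors. The Gaudin Hamiltonians are $H_s(z^0)=\sum_{l\ne s}\frac{\Omega^{(s,l)}}{z^0_s-z^0_l}$, $s=1,\dots,n$. For $J\in\mathcal{I}_k$ the weight function is $$W_J(t,z)=\frac{1}{j_1!\cdots j_n!}\operatorname{Sym}_t\Big[\prod_{s=1}^n\prod_{i=1}^{j_s}\frac{1}{t_{j_1+\dots+j_{s-1}+i}-z_s}\Big],\qquad \operatorname{Sym}_t[F(t_1,\dots,t_k)]=\sum_{\sigma\in S_k}F(t_{\sigma_1},\dots,t_{\sigma_k}),$$ with the convention $W_{J+\mathbf{1}_s}(t^0,z^0)=0$ if $J+\mathbf{1}_s\notin\mathcal{I}_k$. The vector weight function is $W_{k,n,m}(t,z)=\sum_{J\in\mathcal{I}_k}W_J(t,z)f_Jv_m$. *)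

(* Defs.v *)
From HB Require Import structures.
From mathcomp Require Import all_boot all_order all_fingroup all_algebra.

Set Implicit Arguments.
Unset Strict Implicit.
Unset Printing Implicit Defensive.

Import GRing.Theory.
Local Open Scope ring_scope.

(* The sl_2-module L_i has underlying space 'cV[F]_i.+1, where the b-th       *)
(* standard column vector is f^b v_i. Operators are matrices acting on the    *)
(* left, so column b of each matrix below is the image of f^b v_i.            *)
Section IrreducibleModule.
Variable F : fieldType.

Definition fv (i : nat) (b : 'I_i.+1) : 'cV[F]_i.+1 := delta_mx b 0.

Definition sl2e (i : nat) : 'M[F]_i.+1 :=
  \matrix_(a, b) if b == a.+1 :> nat then (b * (i - b).+1)%N%:R else 0.

Definition sl2f (i : nat) : 'M[F]_i.+1 :=
  \matrix_(a, b) if a == b.+1 :> nat then 1 else 0.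

Definition sl2h (i : nat) : 'M[F]_i.+1 :=
  \matrix_(a, b) if a == b then i%:R - 2 * b%:R else 0.

Lemma sl2h_fv i (b : 'I_i.+1) : sl2h i *m fv b = (i%:R - 2 * b%:R) *: fv b.
Proof.
apply/matrixP=> a c; rewrite (ord1 c) -colE !mxE eqxx andbT.
by case: eqP => _; rewrite ?mulr1 ?mulr0.
Qed.

Lemma sl2f_fv i (b : 'I_i.+1) (lt_bi : (b.+1 < i.+1)%N) :
  sl2f i *m fv b = fv (Ordinal lt_bi).
Proof.
apply/matrixP=> a c; rewrite (ord1 c) -colE !mxE eqxx andbT -val_eqE /=.
by case: eqP.
Qed.

Lemma sl2f_fv_max i : sl2f i *m fv (@ord_max i) = 0.
Proof.
apply/matrixP=> a c; rewrite (ord1 c) -colE !mxE /=.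
by case: eqP => // ai; have := ltn_ord a; rewrite ai ltnn.
Qed.

Lemma sl2e_fv0 i : sl2e i *m fv (@ord0 i) = 0.
Proof. by apply/matrixP=> a c; rewrite (ord1 c) -colE !mxE. Qed.

Lemma sl2e_fv i (b : 'I_i.+1) (lt_bi : (b.+1 < i.+1)%N) :
  sl2e i *m fv (Ordinal lt_bi) = (b.+1%:R * (i%:R - b.+1%:R + 1)) *: fv b.
Proof.
apply/matrixP=> a c; rewrite (ord1 c) -colE !mxE eqxx andbT /= eqSS -val_eqE /=.
rewrite eq_sym; case: eqP => _; rewrite ?mulr1 ?mulr0 //.
by rewrite natrM -[X in _ * X]natr1 natrB.
Qed.

End IrreducibleModule.

Section TensorProduct.
Variables (F : fieldType) (n : nat) (m : 'I_n -> nat).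

(* Multi-indices J = (j_1, ..., j_n) with j_s <= m_s. *)
Definition tidx : finType := {dffun forall s : 'I_n, 'I_(m s).+1}.

(* A vector of the tensor product of the L_(m s) is given by its coordinates  *)
(* in the basis f_J v_m.                                                      *)
Definition tens := {ffun tidx -> F^o}.
HB.instance Definition _ := GRing.Lmodule.on tens.

Definition pure_tens (u : forall s : 'I_n, 'cV[F]_((m s).+1)) : tens :=
  [ffun J : tidx => \prod_s u s (J s) 0].

Definition fJv (J : tidx) : tens := pure_tens (fun s => fv F (J s)).

(* The operator acting as A in the s-th tensor factor and as the identity in  *)
(* the others.                                                                *)
Definition on_factor (s : 'I_n) (A : 'M[F]_((m s).+1)) (v : tens) : tens :=
  [ffun J : tidx => \sum_(i < (m s).+1)
     A (J s) i * (v : {ffun _ -> _}) (finfun (dfwith J i))].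

Lemma on_factor_pure s A u :
  on_factor A (pure_tens u) = pure_tens (dfwith u (A *m u s)).
Proof.
apply/ffunP=> J; rewrite !ffunE (bigD1 s) //= dfwith_in mxE mulr_suml.
apply: eq_bigr => i _; rewrite ffunE (bigD1 s) //= ffunE dfwith_in mulrA.
congr (_ * _); apply: eq_bigr => l ls.
by rewrite ffunE !dfwith_out // eq_sym.
Qed.

Lemma fJvE (J J' : tidx) : (fJv J : {ffun _ -> _}) J' = (J' == J)%:R.
Proof.
rewrite ffunE; case: eqP => [->|neq].
  by rewrite big1 // => s _; rewrite mxE !eqxx.
have /existsP[s neqs] : [exists s, J' s != J s].
  rewrite -negb_forall; apply/negP => /forallP eqJ; apply: neq.
  by apply/ffunP=> s; apply/eqP.
by rewrite (bigD1 s) //= mxE (negPf neqs) mul0r.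
Qed.

Lemma tens_basis (v : tens) : v = \sum_J (v : {ffun _ -> _}) J *: fJv J.
Proof.
apply/ffunP=> J; rewrite sum_ffunE (bigD1 J) //= big1 ?addr0.
  by rewrite ffunE fJvE eqxx /GRing.scale /= mulr1.
by move=> J' neq; rewrite ffunE fJvE eq_sym (negPf neq) scaler0.
Qed.

(* On a tensor product of modules x acts as the sum of its factor actions.    *)
Definition tens_act (X : forall i : nat, 'M[F]_i.+1) (v : tens) : tens :=
  \sum_s on_factor (X (m s)) v.

Definition weight_space (lambda : int) : {pred tens} :=
  [pred v : tens | tens_act (@sl2h F) v == lambda%:~R *: v].

Definition Sing (lambda : int) : {pred tens} :=
  [pred v : tens | (v \in weight_space lambda) && (tens_act (@sl2e F) v == 0)].

(* The factors s and l are meant to be distinct. *)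
Definition Casimir (s l : 'I_n) (v : tens) : tens :=
  on_factor (sl2e F (m s)) (on_factor (sl2f F (m l)) v)
  + on_factor (sl2f F (m s)) (on_factor (sl2e F (m l)) v)
  + 2^-1 *: on_factor (sl2h F (m s)) (on_factor (sl2h F (m l)) v).

Definition Gaudin (z : 'I_n -> F) (s : 'I_n) (v : tens) : tens :=
  \sum_(l | l != s) (z s - z l)^-1 *: Casimir s l v.

End TensorProduct.

Arguments weight_space {F n} m lambda.
Arguments Sing {F n} m lambda.

Section WeightFunction.
Variables (F : fieldType) (n k : nat) (m : 'I_n -> nat).

Definition in_I (d : nat) (J : 'I_n -> nat) : bool :=
  (\sum_s J s == d)%N && [forall s, J s <= m s]%N.

Definition add1 (J : 'I_n -> nat) (s : 'I_n) : 'I_n -> nat :=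
  fun l => (J l + (l == s))%N.

(* With indices of t counted from 0, the indices j_1 + ... + j_(s-1) + i,     *)
(* 1 <= i <= j_s, become those in the half-open interval below.               *)
Definition offset (J : 'I_n -> nat) (s : 'I_n) : nat :=
  (\sum_(l < n | (l < s)%N) J l)%N.

Definition in_block (J : 'I_n -> nat) (s : 'I_n) (a : 'I_k) : bool :=
  (offset J s <= a < offset J s + J s)%N.

Definition Sym (G : ('I_k -> F) -> F) (t : 'I_k -> F) : F :=
  \sum_(sigma : 'S_k) G (t \o sigma).

Definition weight_fun (t : 'I_k -> F) (z : 'I_n -> F) (J : 'I_n -> nat) : F :=
  (\prod_s ((J s)`!)%:R)^-1 *
  Sym (fun t' => \prod_s \prod_(a | in_block J s a) (t' a - z s)^-1) t.

(* Division is total in the library: this says that no denominator of         *)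
(* weight_fun t z J vanishes.                                                 *)
Definition weight_fun_defined (t : 'I_k -> F) (z : 'I_n -> F)
    (J : 'I_n -> nat) : Prop :=
  \prod_s ((J s)`!)%:R != 0 :> F /\
  forall (sigma : 'S_k) s a, in_block J s a -> t (sigma a) - z s != 0.

Definition weight_fun0 (t : 'I_k -> F) (z : 'I_n -> F) (J : 'I_n -> nat) : F :=
  if in_I k J then weight_fun t z J else 0.

Definition weight_vec (t : 'I_k -> F) (z : 'I_n -> F) : tens F m :=
  \sum_(J : tidx m | in_I k (fun s => J s))
     weight_fun t z (fun s => J s) *: fJv F J.

Definition Bethe_solution (z : 'I_n -> F) (t : 'I_k -> F) : Prop :=
  [/\ forall i j, j != i -> t i - t j != 0,
      forall i s, t i - z s != 0
    & forall i, \sum_(j | j != i) 2 / (t i - t j)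
                - \sum_s (m s)%:R / (t i - z s) = 0].

Definition Gaudin_eigenvalue (t : 'I_k -> F) (z : 'I_n -> F) (s : 'I_n) : F :=
  \sum_(l | l != s) ((m s)%:R * (m l)%:R / 2) / (z s - z l)
  - \sum_i (m s)%:R / (z s - t i).

End WeightFunction.

(* Main.v *)
(* The weight vector is the Bethe vector f(t_1)...f(t_k) v, where             *)
(* f(t) = \sum_s f_s / (t - z_s) and v is the tensor product of the highest   *)
(* weight vectors. Moving e = \sum_s e_s, or the Hamiltonian H_s, through the *)
(* commuting factors f(t_i) leaves, besides the eigenvalue term, the sum over *)
(* i of the i-th Bethe equation times f(t_1)...f(t_k) v with the factor       *)
(* f(t_i) omitted, or replaced by - f_s / (t_i - z_s). Only the commutators   *)
(* [e_s, f_s] = h_s and [h_s, f_s] = - 2 f_s and partial fractions are used.  *)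
(* In coordinates, Sym is a permanent whose expansion along t_1 matches the   *)
(* action of f(t_1).                                                          *)
From HB Require Import structures.
Require Import Defs.
From mathcomp Require Import all_boot all_order all_fingroup all_algebra.
From mathcomp Require Import ring.

Set Implicit Arguments.
Unset Strict Implicit.
Unset Printing Implicit Defensive.

Import GRing.Theory.
Local Open Scope ring_scope.

(** Everything follows from off-shell identities, valid for arbitrary distinct t_i away from the
    z_s. Let f(u), h(u) be the currents and B = f(t_1)...f(t_k) v. Moving h(u) past f(t_i) produces
    2 (f(u) - f(t_i)) / (u - t_i); the parts with f(t_i) restore B, and their scalars add up to the
    Bethe expression at u ([current_h_bethe]). Since [e, f(t)] = h(t), e B is the sum over i of the
    defect at t_i times B without f(t_i) ([e_bethe]). Since [H_s, f(t)] = (f(t) h_s - f_s h(t)) / (t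
    - z_s), H_s B is lambda_s B minus f_s applied to the same sum with weights defect / (t_i - z_s)
    ([hamiltonian_bethe]). The Bethe equations make all defects zero.

    It remains to identify B with the weight vector. The coefficient of f_J v in B is a sum over
    colourings of the t_i by tensor factors, colour s being used j_s times ([coord_bethe]). The
    symmetrization in W_J counts each colouring j_1!...j_n! times ([permanent_arrangement_sum]), and
    p > |m| makes these factorials invertible, so the prefactor of W_J cancels them
    ([weight_vec_bethe]). The scalar relations are the coordinates of e B = 0 ([sing_relation]). *)

(** * Off-shell Bethe vectors *)

Section GaudinAlgebra.
Variables (F : fieldType) (V : lmodType F) (n : nat).
Variables (e f h : 'I_n -> {linear V -> V}) (z : 'I_n -> F).

Definition current (x : 'I_n -> {linear V -> V}) (t : F) (v : V) : V :=
  \sum_s (t - z s)^-1 *: x s v.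

Lemma current_is_linear x t : linear (current x t).
Proof.
move=> a u v; rewrite /current scaler_sumr -big_split; apply: eq_bigr => s _.
by rewrite linearP scalerDr !scalerA mulrC.
Qed.
HB.instance Definition _ x t :=
  GRing.isLinear.Build F V V _ (current x t) (current_is_linear x t).

Definition omega (s l : 'I_n) (v : V) : V :=
  e s (f l v) + f s (e l v) + 2^-1 *: h s (h l v).

Lemma omega_is_linear s l : linear (omega s l).
Proof.
move=> a u v; rewrite /omega !linearP /= !scalerDr !scalerA (mulrC a).
by rewrite (addrACA (a *: e s (f l u))) [LHS]addrACA.
Qed.
HB.instance Definition _ s l :=
  GRing.isLinear.Build F V V _ (omega s l) (omega_is_linear s l).

Definition hamiltonian (s : 'I_n) (v : V) : V :=
  \sum_(l | l != s) (z s - z l)^-1 *: omega s l v.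

Hypothesis ffC : forall s l v, f s (f l v) = f l (f s v).
Hypothesis hfC : forall s l v,
  h s (f l v) = f l (h s v) - (2 * (s == l)%:R) *: f l v.
Hypothesis efC : forall s l v, e s (f l v) = f l (e s v) + (s == l)%:R *: h l v.

Lemma f_current s t v : f s (current f t v) = current f t (f s v).
Proof.
by rewrite linear_sum; apply: eq_bigr => l _; rewrite linearZ /= ffC.
Qed.

Lemma current_current t u v :
  current f t (current f u v) = current f u (current f t v).
Proof.
rewrite {1}/current linear_sum; apply: eq_bigr => s _.
by rewrite f_current linearZ.
Qed.

Lemma h_current s t v :
  h s (current f t v) = current f t (h s v) - (2 / (t - z s)) *: f s v.
Proof.
rewrite linear_sum /= /current.
under eq_bigr do rewrite linearZ /= hfC scalerBr scalerA.
rewrite sumrB; congr (_ - _); rewrite (bigD1 s) //= big1 ?addr0.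
  by rewrite eqxx mulr1 mulrC.
by move=> l; rewrite eq_sym => /negPf ->; rewrite !mulr0 scale0r.
Qed.

(** Partial fractions split the commutator term -2 / ((u - z_s) (t - z_s)) into 2 / (u - t) times
    the difference of the two simple poles. *)
Lemma h_current_current u t v : u != t ->
    (forall s, u != z s) -> (forall s, t != z s) ->
  current h u (current f t v) =
    current f t (current h u v) + (2 / (u - t)) *: (current f u v - current f t v).
Proof.
move=> ut uz tz; rewrite {1}/current.
under eq_bigr do rewrite h_current scalerBr scalerA.
rewrite sumrB; congr (_ + _).
  by rewrite [current h u v]/current linear_sum; apply: eq_bigr => s _; rewrite linearZ.
rewrite /current -sumrB scaler_sumr -sumrN; apply: eq_bigr => s _.
rewrite -scalerBl scalerA -scaleNr; congr (_ *: _).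
by field; rewrite !subr_eq0 ut uz tz.
Qed.

Lemma e_current t v :
  \sum_s e s (current f t v) = current f t (\sum_s e s v) + current h t v.
Proof.
under eq_bigr do rewrite /current linear_sum /=.
rewrite exchange_big linear_sum /= /current.
rewrite [X in _ = X + _]exchange_big -big_split /=; apply: eq_bigr => l _.
under eq_bigr do rewrite linearZ /= efC scalerDr.
rewrite big_split /=; congr (_ + _); rewrite (bigD1 l) //= big1 ?addr0.
  by rewrite eqxx scale1r.
by move=> s /negPf ->; rewrite scale0r scaler0.
Qed.

(** The antisymmetry in s and l expresses that Omega commutes with the coproduct f_s + f_l. For r =
    s, the term e_s f_l yields f_l h_s and half of h_s h_l yields - f_s h_l. *)
Lemma omega_f s l r v : 2 != 0 :> F -> l != s ->
  omega s l (f r v) = f r (omega s l v)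
    + ((r == s)%:R - (r == l)%:R) *: (f l (h s v) - f s (h l v)).
Proof.
move=> two_neq0 ls; have sl : (s == l) = false by rewrite eq_sym (negPf ls).
have half2 : 2^-1 * 2 = 1 :> F by rewrite mulVf.
have half C : 2^-1 *: (2 *: C) = C :> V by rewrite scalerA half2 scale1r.
have E1 : e s (f l (f r v)) = f r (e s (f l v)) + (r == s)%:R *: f l (h s v).
  rewrite ffC efC eq_sym; congr (_ + _).
  have [->|_] := eqVneq r s; last by rewrite !scale0r.
  by rewrite hfC sl mulr0 scale0r subr0.
have E2 : f s (e l (f r v)) = f r (f s (e l v)) + (r == l)%:R *: f s (h l v).
  rewrite efC linearD linearZ /= (ffC r) (eq_sym r); congr (_ + _).
  by have [->|_] := eqVneq l r; rewrite ?scale0r.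
have E3 : 2^-1 *: h s (h l (f r v)) = f r (2^-1 *: h s (h l v))
    - ((r == s)%:R *: f s (h l v) + (r == l)%:R *: f l (h s v)).
  rewrite [f r (2^-1 *: _)]linearZ /= hfC linearB linearZ /= [h s (f r _)]hfC.
  rewrite (eq_sym r s) (eq_sym r l).
  have [<-|_] := eqVneq s r; last rewrite mulr0 !scale0r subr0.
    rewrite (eq_sym l) sl mulr1 mulr0 !scale0r subr0 addr0.
    by rewrite scale1r scalerBr half.
  have [<-|_] := eqVneq l r; last by rewrite mulr0 !scale0r !subr0 add0r subr0.
  by rewrite hfC sl mulr1 mulr0 scale0r subr0 add0r scale1r scalerBr half.
rewrite /omega E1 E2 E3 [f r (_ + _ + _)]linearD [f r (_ + _)]linearD /= scalerBr !scalerBl.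
rewrite [X in X + _ = _]addrACA [LHS]addrACA; congr (_ + _).
by rewrite opprB opprD (addrC (- _)) addrACA.
Qed.

(** By [omega_f] the pair (s, l) contributes with a difference of poles at z_s and z_l, which the
    factor 1 / (z_s - z_l) turns into 1 / ((t - z_s) (t - z_l)). The condition on 2 is tied to the
    existence of a second factor so that p = 2 with n = 1 is covered. *)
Lemma hamiltonian_current s t v : (forall l, l != s -> 2 != 0 :> F) ->
    injective z -> (forall l, t != z l) ->
  hamiltonian s (current f t v) = current f t (hamiltonian s v)
    + (t - z s)^-1 *: (current f t (h s v) - f s (current h t v)).
Proof.
move=> two_neq0 z_inj tz; rewrite {1}/hamiltonian.
have om l : l != s -> omega s l (current f t v) = current f t (omega s l v)
    + ((t - z s)^-1 - (t - z l)^-1) *: (f l (h s v) - f s (h l v)).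
  move=> ls; rewrite /current linear_sum /=.
  under eq_bigr do rewrite linearZ /= omega_f ?(two_neq0 l) // scalerDr scalerA.
  rewrite big_split -scaler_suml /=; congr (_ + _ *: _).
  under eq_bigr do rewrite mulrBr !mulr_natr !mulrb.
  by rewrite sumrB -!big_mkcond !big_pred1_eq.
under eq_bigr => l ls do rewrite om // scalerDr scalerA.
rewrite big_split /=; congr (_ + _).
  by rewrite linear_sum; apply: eq_bigr => l _; rewrite linearZ.
rewrite {1}/current [f s _]linear_sum -sumrB scaler_sumr.
(* The Hamiltonian has no summand l = s; on the right that summand is f_s h_s - f_s h_s = 0. *)
rewrite [RHS](bigD1 s) //= linearZ /= subrr scaler0 add0r.
apply: eq_bigr => l ls; rewrite linearZ /= -scalerBr scalerA; congr (_ *: _).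
by field; rewrite !subr_eq0 !tz (inj_eq z_inj) eq_sym ls.
Qed.

(** * Action on products of currents applied to a highest weight vector *)

Variables (v0 : V) (mu : 'I_n -> F).
Hypothesis e_v0 : forall s, e s v0 = 0.
Hypothesis h_v0 : forall s, h s v0 = mu s *: v0.

Fixpoint bethe (ts : seq F) : V :=
  if ts is t :: ts' then current f t (bethe ts') else v0.

(* The sum over i of phi t_i times the Bethe vector of ts without t_i. *)
Fixpoint bethe_deriv (phi : F -> F) (ts : seq F) : V :=
  if ts is t :: ts' then phi t *: bethe ts' + current f t (bethe_deriv phi ts')
  else 0.

Lemma eq_bethe_deriv phi psi ts : {in ts, phi =1 psi} -> bethe_deriv phi ts = bethe_deriv psi ts.
Proof.
elim: ts => //= t ts IH eq_pp; rewrite eq_pp ?mem_head // IH // => x xts.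
by rewrite eq_pp // inE xts orbT.
Qed.

Lemma bethe_derivD phi psi ts :
  bethe_deriv (fun x => phi x + psi x) ts = bethe_deriv phi ts + bethe_deriv psi ts.
Proof.
by elim: ts => [|t ts /= ->] /=; rewrite ?addr0 // linearD scalerDl addrACA.
Qed.

Lemma bethe_derivZ c phi ts : bethe_deriv (fun x => c * phi x) ts = c *: bethe_deriv phi ts.
Proof.
elim: ts => [|t ts /= ->] /=; first by rewrite scaler0.
by rewrite linearZ scalerDr scalerA.
Qed.

Lemma bethe_deriv_eq0 phi ts : {in ts, forall x, phi x = 0} -> bethe_deriv phi ts = 0.
Proof.
move=> phi0; rewrite (@eq_bethe_deriv _ (fun=> 0 * 0)) ?bethe_derivZ ?scale0r // => x xts.
by rewrite phi0 // mulr0.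
Qed.

(* Opposite to the left-hand side of the Bethe equation at x; a summand with  *)
(* t = x vanishes because 0^-1 = 0.                                           *)
Definition defect (ts : seq F) (x : F) : F :=
  \sum_s mu s / (x - z s) - \sum_(t <- ts) 2 / (x - t).

Lemma defect_cons t ts x : defect (t :: ts) x = defect ts x - 2 / (x - t).
Proof. by rewrite /defect big_cons opprD addrA addrAC. Qed.

Lemma defect_self t ts : defect (t :: ts) t = defect ts t.
Proof. by rewrite defect_cons subrr invr0 mulr0 subr0. Qed.

Lemma h_bethe s ts :
  h s (bethe ts) = mu s *: bethe ts - 2 *: f s (bethe_deriv (fun x => (x - z s)^-1) ts).
Proof.
elim: ts => [|t ts IH] /=; first by rewrite linear0 scaler0 subr0.
rewrite h_current IH linearB !linearZ /= -f_current [f s (_ + _)]linearD linearZ /=.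
by rewrite opprD -scalerN scalerDr scalerA -addrA (addrC (2 *: _)).
Qed.

(** In each commutator with f(t), the f(t) part restores the Bethe vector and adds -2 / (u - t) to
    the defect, while the f(u) part puts u in place of t. *)
Lemma current_h_bethe u ts :
    u \notin ts -> (forall s, u != z s) -> {in ts, forall t s, t != z s} ->
  current h u (bethe ts) = defect ts u *: bethe ts
    + 2 *: current f u (bethe_deriv (fun x => (u - x)^-1) ts).
Proof.
move=> + uz; elim: ts => [|t ts IH] /=.
  move=> _ _; rewrite linear0 scaler0 addr0 /current /defect big_nil subr0.
  rewrite scaler_suml; apply: eq_bigr => s _.
  by rewrite h_v0 scalerA mulrC.
rewrite inE negb_or => /andP[ut uts] tsz.
rewrite h_current_current // ?tsz ?mem_head //; last first.
  by move=> s; rewrite tsz ?mem_head.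
rewrite IH // => [|x xts s]; last by rewrite tsz // inE xts orbT.
rewrite defect_cons linearD !linearZ /= (current_current t).
rewrite [current f u (_ + _)]linearD linearZ /= [in RHS]scalerBl scalerBr scalerDr.
rewrite scalerA [X in _ = _ + X]addrC [RHS]addrACA; congr (_ + _).
exact: addrC.
Qed.

(** Adding t in front of [ts] creates h(t) acting on the shorter vector: its scalar is the defect at
    t, and its exchange terms 2 / (t - x) are what each older defect at x gains from t. *)
Lemma e_bethe ts : uniq ts -> {in ts, forall t s, t != z s} ->
  \sum_s e s (bethe ts) = bethe_deriv (defect ts) ts.
Proof.
elim: ts => [|t ts IH] /=; first by move=> _ _; apply: big1 => s _.
case/andP=> tts uts tsz.
have tsz' : {in ts, forall t s, t != z s}.
  by move=> x xts s; rewrite tsz // inE xts orbT.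
rewrite e_current IH // current_h_bethe // => [|s]; last first.
  by rewrite tsz ?mem_head.
rewrite defect_self addrCA; congr (_ + _); rewrite -linearZ -linearD.
rewrite -bethe_derivZ -bethe_derivD; congr (current _ _ _); apply: eq_bethe_deriv => x xts.
by rewrite defect_cons -[t - x]opprB invrN mulrN.
Qed.

Lemma hamiltonian_v0 s :
  hamiltonian s v0 =
    (\sum_(l | l != s) (mu s * mu l / 2) / (z s - z l)) *: v0.
Proof.
rewrite scaler_suml; apply: eq_bigr => l /negPf ls.
rewrite /omega efC !e_v0 !linear0 eq_sym ls scale0r !add0r.
rewrite h_v0 [h s _]linearZ /= h_v0 !scalerA; congr (_ *: _).
by rewrite -[LHS]mulrA (mulrC (mu l)) [LHS]mulrC -[RHS]mulrA (mulrC 2^-1).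
Qed.

Lemma hamiltonian_bethe s ts : (forall l, l != s -> 2 != 0 :> F) ->
    injective z -> uniq ts -> {in ts, forall t l, t != z l} ->
  hamiltonian s (bethe ts) =
    (\sum_(l | l != s) (mu s * mu l / 2) / (z s - z l)
       - \sum_(t <- ts) mu s / (z s - t)) *: bethe ts
    - f s (bethe_deriv (fun x => defect ts x / (x - z s)) ts).
Proof.
move=> two_neq0 z_inj; elim: ts => [|t ts IH] /=.
  by move=> _ _; rewrite hamiltonian_v0 big_nil linear0 !subr0.
case/andP=> tts uts tsz.
have tsz' : {in ts, forall t s, t != z s}.
  by move=> x xts l; rewrite tsz // inE xts orbT.
have tz l : t != z l by rewrite tsz ?mem_head.
rewrite hamiltonian_current // IH // current_h_bethe // h_bethe.
set D0 := bethe_deriv _ ts; set D1 := bethe_deriv _ ts; set D2 := bethe_deriv _ ts.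
(* The defect at x gains 2 / (t - x) from t, and 1 / ((t - x) (x - z_s)) equals 1 / (t - z_s) times
   the sum of 1 / (x - z_s) and 1 / (t - x). These are the weights of [D1], coming from h_s, and of
   [D2], coming from h(t). *)
have -> : bethe_deriv (fun x => defect (t :: ts) x / (x - z s)) ts
    = D0 + (t - z s)^-1 *: (2 *: D1 + 2 *: D2).
  rewrite -!(bethe_derivZ, bethe_derivD); apply: eq_bethe_deriv => x xts; rewrite defect_cons.
  have tx : t != x by apply: contraNneq tts => ->.
  by field; rewrite !subr_eq0 tz tsz' // tx eq_sym tx.
rewrite big_cons defect_self opprD addrCA.
set L := \sum_(l | _) _ - _; set c := (t - z s)^-1; set B := bethe ts.
(* The eigenvalue summand of t comes from h_s acting by [mu s] in f(t) h_s / (t - z_s). *)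
have -> : - (mu s / (z s - t)) = c * mu s.
  by rewrite -mulrN -invrN opprB mulrC.
rewrite [(_ + L) *: _]scalerDl (addrC ((c * mu s) *: _)) [defect ts t * c]mulrC.
have -> : current f t (L *: B - f s D0) = L *: current f t B - f s (current f t D0).
  by rewrite linearB linearZ /= f_current.
have -> : current f t (mu s *: B - 2 *: f s D1)
    = mu s *: current f t B - 2 *: f s (current f t D1).
  by rewrite linearB !linearZ /= f_current.
have -> : f s (defect ts t *: B + 2 *: current f t D2)
    = defect ts t *: f s B + 2 *: f s (current f t D2).
  by rewrite linearD !linearZ.
have lin (g : {linear V -> V}) x y w : g (x + c *: (2 *: y + 2 *: w))
    = g x + c *: (2 *: g y + 2 *: g w).
  by rewrite linearD linearZ /= [g (_ + _)]linearD !linearZ.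
have -> : f s ((c * defect ts t) *: B + current f t (D0 + c *: (2 *: D1 + 2 *: D2)))
    = c *: (defect ts t *: f s B) + (f s (current f t D0)
      + c *: (2 *: f s (current f t D1) + 2 *: f s (current f t D2))).
  by rewrite lin [LHS]linearD linearZ /= lin scalerA.
rewrite -[(c * mu s) *: _]scalerA.
have reorder A B0 X Y P Q : (A - B0) + c *: ((X - P) - (Y + Q))
    = A + c *: X - (c *: Y + (B0 + c *: (P + Q))) :> V.
  rewrite -[X - P - _]addrA -opprD (addrCA P) scalerBr scalerDr addrACA.
  by rewrite -opprD (addrCA B0).
exact: reorder.
Qed.

End GaudinAlgebra.

(** * The weight function as a permanent *)

(** Permutations are sorted by the preimage b of 0; this is the Laplace expansion of a permanent
    along its first row. *)
Lemma big_lift_perm (R : nmodType) k (G : 'S_k.+1 -> R) :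
  \sum_(sigma : 'S_k.+1) G sigma = \sum_b \sum_(tau : 'S_k) G (lift_perm b ord0 tau).
Proof.
rewrite pair_bigA /= (reindex (fun u => lift_perm u.1 ord0 u.2)) //.
apply: onW_bij; apply: inj_card_bij => [[b u] [b' u'] /= eq_lift|]; last first.
  by rewrite card_prod !card_Sn card_ord factS.
have eq_b : b = b'.
  by apply: (@perm_inj _ (lift_perm b ord0 u)); rewrite {2}eq_lift !lift_perm_id.
rewrite -eq_b in eq_lift *; congr (_, _); apply/permP=> a.
by apply: (@lift_inj _ ord0); rewrite -!(lift_perm_lift b) eq_lift.
Qed.

Section WeightCoefficient.
Variables (F : fieldType) (n : nat) (z : 'I_n -> F).
Implicit Types (J : 'I_n -> nat) (ts : seq F).

(* The sum of \prod_a (t_a - z_(c a))^-1 over all colourings c of the entries *)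
(* t_a of ts in which colour s occurs J s times.                             *)
Fixpoint arrangement_sum ts J : F :=
  if ts is t :: ts' then
    \sum_(s | (0 < J s)%N) (t - z s)^-1 * arrangement_sum ts' (fun l => J l - (l == s))%N
  else [forall s, J s == 0%N]%:R.

Lemma eq_arrangement_sum ts J J' : J =1 J' -> arrangement_sum ts J = arrangement_sum ts J'.
Proof.
elim: ts J J' => [|t ts IH] J J' eqJ /=.
  by congr (_%:R); congr nat_of_bool; apply: eq_forallb => s; rewrite eqJ.
apply: eq_big => [s|s _]; first by rewrite eqJ.
by congr (_ * _); apply: IH => l; rewrite eqJ.
Qed.

Definition fibre_size k (c : 'I_k -> 'I_n) (s : 'I_n) : nat := \sum_a (c a == s).

(** Permuting positions of equal colour does not change the product, so each colouring with the
    fibre sizes of [c] arises from as many permutations as the product of the factorials. The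
    induction expands along the first entry of t. *)
Lemma permanent_arrangement_sum k (t : 'I_k -> F) (c : 'I_k -> 'I_n) :
  \sum_(sigma : 'S_k) \prod_a (t (sigma a) - z (c a))^-1 =
  (\prod_s (fibre_size c s)`!)%:R * arrangement_sum [seq t i | i <- enum 'I_k] (fibre_size c).
Proof.
elim: k t c => [|k IH] t c.
  rewrite (big_pred1 1%g) => [|u]; last by apply/esym/eqP/permP => -[].
  rewrite big_ord0 big1 => [|s _]; last by rewrite /fibre_size big_ord0.
  rewrite (size0nil (size_enum_ord 0)) /= mul1r; case: forallP => // -[] s.
  by rewrite /fibre_size big_ord0.
rewrite big_lift_perm enum_ordSl /= -map_comp.
have size_lift b : fibre_size (c \o lift b) =1 (fun s => fibre_size c s - (s == c b))%N.
  by move=> s; rewrite /fibre_size (bigD1_ord b) //= [s == _]eq_sym addKn.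
transitivity (\sum_b (t ord0 - z (c b))^-1
   * ((\prod_s (fibre_size c s - (s == c b))`!)%:R
      * arrangement_sum [seq (t \o lift ord0) i | i <- enum 'I_k]
          (fun s => fibre_size c s - (s == c b))%N)).
  apply: eq_bigr => b _.
  have split_b (u : 'S_k) :
      \prod_a (t (lift_perm b ord0 u a) - z (c a))^-1 = (t ord0 - z (c b))^-1
        * \prod_a ((t \o lift ord0) (u a) - z ((c \o lift b) a))^-1.
    rewrite (bigD1_ord b) //= lift_perm_id; congr (_ * _).
    by apply: eq_bigr => a _; rewrite lift_perm_lift.
  rewrite (eq_bigr _ (fun u _ => split_b u)).
  rewrite -mulr_sumr (IH (t \o lift ord0) (c \o lift b)); congr (_ * (_%:R * _)).
    by apply: eq_bigr => s _; rewrite size_lift.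
  exact: eq_arrangement_sum.
(* The summand depends on b only through its colour s, so each colour is counted N times, N being
   its fibre size, and N times (N - 1)! restores N!. *)
rewrite (partition_big c xpredT) //= mulr_sumr [RHS]big_mkcond /=.
apply: eq_bigr => s _.
under eq_bigr => b /eqP-> do idtac.
rewrite sumr_const.
have -> : #|[pred b | c b == s]| = fibre_size c s.
  rewrite -sum1_card big_mkcond /=; apply: eq_bigr => b _.
  by rewrite inE; case: eqP.
case: posnP => [->//|size_gt0].
rewrite [RHS]mulrCA -mulrnAr -mulrnAl -mulrnA; congr (_ * (_%:R * _)).
rewrite (bigD1 s) //= [RHS](bigD1 s) //= eqxx subn1 mulnAC; congr (_ * _)%N.
  by case: (fibre_size c s) size_gt0 => // N _; rewrite factS mulnC.
by apply: eq_bigr => l /negPf->; rewrite subn0.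
Qed.

(** The cut-off is a natural number rather than an ordinal, so that the end of block s is the value
    at s + 1 and the total is the value at n. *)
Definition offset_upto J (i : nat) : nat := \sum_(l < n | (l < i)%N) J l.

Lemma offset_upto_mono J i j : (i <= j)%N -> (offset_upto J i <= offset_upto J j)%N.
Proof.
move=> le_ij; rewrite /offset_upto big_mkcond [leqRHS]big_mkcond /=.
apply: leq_sum => l _; case: ifP => // li; by rewrite (leq_trans li le_ij).
Qed.

Lemma offset_uptoS J (s : 'I_n) : offset_upto J s.+1 = (offset J s + J s)%N.
Proof.
rewrite /offset_upto (bigD1 s) //= addnC; congr (_ + _)%N; apply: eq_bigl => l.
by rewrite ltnS andbC -ltn_neqAle.
Qed.

Lemma offset_upto_total J : offset_upto J n = \sum_s J s.
Proof. by apply: eq_bigl => s; rewrite ltn_ord. Qed.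

Lemma offset_upto0 J : offset_upto J 0 = 0%N.
Proof. exact: big_pred0. Qed.

Lemma in_block_inj k J (a : 'I_k) s s' :
  in_block J s a -> in_block J s' a -> s = s'.
Proof.
wlog lt_ss' : s s' / (s < s')%N => [W|] sa s'a.
  have [lt|lt|/val_inj//] := ltngtP s s'; first exact: W.
  by apply/esym/W.
have /andP[_] := sa; have /andP[+ _] := s'a => s'a1 sa2.
rewrite -offset_uptoS in sa2.
by have := leq_trans sa2 (offset_upto_mono J lt_ss'); rewrite ltnNge s'a1.
Qed.

Lemma in_block_exists k J (a : 'I_k) :
  \sum_s J s = k -> exists s, in_block J s a.
Proof.
move=> sumJ; have ex_i : exists i, (a < offset_upto J i)%N.
  by exists n; rewrite offset_upto_total sumJ.
(* The least i with a below the partial sum is a successor; its predecessor is the block of a. *)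
case: (ex_minnP ex_i) => -[|i]; first by rewrite offset_upto0.
move=> lt_a min_i; have lt_in : (i < n)%N.
  by apply: min_i; rewrite offset_upto_total sumJ.
exists (Ordinal lt_in); rewrite /in_block -offset_uptoS lt_a andbT leqNgt.
by apply/negP => /min_i; rewrite ltnn.
Qed.

Lemma card_in_block k J s : \sum_s J s = k ->
  (\sum_(a < k) in_block J s a)%N = J s.
Proof.
move=> sumJ; have le_k : (offset J s + J s <= k)%N.
  by rewrite -offset_uptoS -sumJ -offset_upto_total offset_upto_mono.
transitivity (\sum_(offset J s <= i < offset J s + J s) 1)%N.
  rewrite (big_nat_widen _ _ k) // (big_nat_widenl _ 0) // big_mkord.
  rewrite [RHS]big_mkcond; apply: eq_bigr => a _.
  by rewrite /in_block andbC; case: ifP.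
by rewrite sum_nat_const_nat muln1 addKn.
Qed.

(** The blocks colour the k positions with J_s of them in colour s, so the symmetrization is the
    permanent above, whose factorials cancel the prefactor. *)
Lemma weight_fun_arrangement_sum k (t : 'I_k -> F) J :
    \sum_s J s = k -> (\prod_s (J s)`!)%:R != 0 :> F ->
  weight_fun t z J = arrangement_sum [seq t i | i <- enum 'I_k] J.
Proof.
move=> sumJ J_neq0; pose c a := xchoose (in_block_exists a sumJ).
have cP a s : in_block J s a = (c a == s).
  apply/idP/eqP => [|<-]; last exact: xchooseP (in_block_exists a sumJ).
  exact/in_block_inj/(xchooseP (in_block_exists a sumJ)).
have size_c : fibre_size c =1 J.
  by move=> s; rewrite -[RHS](card_in_block s sumJ); apply: eq_bigr => a _; rewrite cP.
transitivity ((\prod_s (J s)`!)%:R^-1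
    * \sum_(u : 'S_k) \prod_a (t (u a) - z (c a))^-1).
  rewrite /weight_fun natr_prod; congr (_ * _); apply: eq_bigr => u _.
  under eq_bigr do rewrite big_mkcond.
  rewrite exchange_big; apply: eq_bigr => a _.
  rewrite -big_mkcond (big_pred1 (c a)) // => s.
  by rewrite cP eq_sym.
rewrite permanent_arrangement_sum (eq_arrangement_sum _ size_c).
have -> : (\prod_s (fibre_size c s)`! = \prod_s (J s)`!)%N.
  by apply: eq_bigr => s _; rewrite size_c.
by rewrite mulKf.
Qed.

End WeightCoefficient.

(** * Operators on the tensor product *)

Section Sl2Matrices.
Variable F : fieldType.

Lemma mx_fvP i (A B : 'M[F]_i.+1) : (forall b, A *m fv F b = B *m fv F b) -> A = B.
Proof.
move=> eqAB; apply/matrixP=> a b.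
by have /matrixP/(_ a 0) := eqAB b; rewrite -!colE !mxE.
Qed.

Lemma sl2_hf i : sl2h F i *m sl2f F i = sl2f F i *m sl2h F i - 2 *: sl2f F i.
Proof.
apply: mx_fvP => b; rewrite mulmxBl -!mulmxA -scalemxAl sl2h_fv -scalemxAr.
have [lt_bi|] := ltnP b i.
  rewrite (sl2f_fv F (b := b) lt_bi) sl2h_fv -scalerBl; congr (_ *: _).
  by rewrite /= -natr1; ring.
move=> le_ib; have -> : b = ord_max.
  by apply/val_inj/anti_leq; rewrite le_ib -ltnS ltn_ord.
by rewrite sl2f_fv_max !scaler0 mulmx0 subr0.
Qed.

(** The formula also covers b = 0, where both sides vanish, so that only the top vector needs
    separate care in [sl2_ef]. *)
Lemma sl2f_e_fv i (b : 'I_i.+1) :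
  sl2f F i *m (sl2e F i *m fv F b) = (b%:R * (i%:R - b%:R + 1)) *: fv F b.
Proof.
case: b => -[|b] lt_bi.
  by rewrite (_ : Ordinal lt_bi = ord0) ?sl2e_fv0 ?mulmx0 ?mul0r ?scale0r //; apply: val_inj.
have lt_b : (b < i.+1)%N by apply: ltnW.
rewrite (sl2e_fv F (b := Ordinal lt_b)) -scalemxAr.
by rewrite (sl2f_fv F (b := Ordinal lt_b)).
Qed.

Lemma sl2_ef i : sl2e F i *m sl2f F i = sl2f F i *m sl2e F i + sl2h F i.
Proof.
apply: mx_fvP => b; rewrite mulmxDl -!mulmxA sl2f_e_fv sl2h_fv -scalerDl.
have [lt_bi|] := ltnP b i.
  rewrite (sl2f_fv F (b := b) lt_bi) sl2e_fv; congr (_ *: _).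
  by rewrite -natr1; ring.
move=> le_ib; have -> : b = ord_max.
  by apply/val_inj/anti_leq; rewrite le_ib -ltnS ltn_ord.
rewrite sl2f_fv_max mulmx0 -[LHS](scale0r (fv F ord_max)); congr (_ *: _).
by rewrite /=; ring.
Qed.

End Sl2Matrices.

Section TensorOperators.
Variables (F : fieldType) (n : nat) (m : 'I_n -> nat).
Local Notation tensor := (tens F m).
Local Notation coord v J := ((v : {ffun tidx m -> F^o}) J).

Definition update (J : tidx m) s (i : 'I_(m s).+1) : tidx m := finfun (dfwith J i).

Lemma update_in J s (i : 'I_(m s).+1) : update J i s = i.
Proof. by rewrite ffunE dfwith_in. Qed.

Lemma update_out J s (i : 'I_(m s).+1) l : s != l -> update J i l = J l.
Proof. by move=> sl; rewrite ffunE dfwith_out. Qed.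

Lemma updateC J s l (i : 'I_(m s).+1) (j : 'I_(m l).+1) : s != l ->
  update (update J i) j = update (update J j) i.
Proof.
move=> sl; apply/ffunP=> r; have [<-|lr] := eqVneq l r.
  by rewrite update_in update_out // update_in.
rewrite update_out //; have [<-|sr] := eqVneq s r; first by rewrite !update_in.
by rewrite !update_out.
Qed.

Lemma update_update J s (i j : 'I_(m s).+1) : update (update J i) j = update J j.
Proof.
apply/ffunP=> r; have [<-|sr] := eqVneq s r; first by rewrite !update_in.
by rewrite !update_out.
Qed.

Lemma on_factorE s (A : 'M[F]_((m s).+1)) (v : tensor) J :
  coord (on_factor A v) J = \sum_i A (J s) i * coord v (update J i).
Proof. by rewrite ffunE. Qed.

Lemma on_factor_is_linear s (A : 'M[F]_((m s).+1)) :
  linear (on_factor A : tensor -> tensor).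
Proof.
move=> a u v; apply/ffunP=> J; rewrite !ffunE.
rewrite scaler_sumr -big_split; apply: eq_bigr => i _.
by rewrite !ffunE /GRing.scale /= mulrDr mulrCA.
Qed.
HB.instance Definition _ s (A : 'M[F]_((m s).+1)) :=
  GRing.isLinear.Build F tensor tensor _ (on_factor A) (on_factor_is_linear A).

Lemma on_factorM s (A B : 'M[F]_((m s).+1)) (v : tensor) :
  on_factor A (on_factor B v) = on_factor (A *m B) v.
Proof.
apply/ffunP=> J; rewrite !on_factorE.
under eq_bigr do rewrite on_factorE update_in mulr_sumr.
rewrite exchange_big; apply: eq_bigr => i _; rewrite mxE mulr_suml.
by apply: eq_bigr => j _; rewrite update_update mulrA.
Qed.

Lemma on_factorC s l (A : 'M[F]_((m s).+1)) (B : 'M[F]_((m l).+1)) (v : tensor) :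
  s != l -> on_factor A (on_factor B v) = on_factor B (on_factor A v).
Proof.
move=> sl; apply/ffunP=> J; rewrite !on_factorE.
under eq_bigr do rewrite on_factorE update_out // mulr_sumr.
rewrite exchange_big; apply: eq_bigr => i _.
rewrite on_factorE mulr_sumr; apply: eq_bigr => j _.
by rewrite updateC // update_out 1?eq_sym // mulrCA.
Qed.

Lemma on_factorDmx s (A B : 'M[F]_((m s).+1)) (v : tensor) :
  on_factor (A + B) v = on_factor A v + on_factor B v.
Proof.
apply/ffunP=> J; rewrite [RHS]ffunE !on_factorE -big_split.
by apply: eq_bigr => i _; rewrite mxE mulrDl.
Qed.

Lemma on_factorZmx s c (A : 'M[F]_((m s).+1)) (v : tensor) :
  on_factor (c *: A) v = c *: on_factor A v.
Proof.
apply/ffunP=> J; rewrite [RHS]ffunE !on_factorE scaler_sumr.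
by apply: eq_bigr => i _; rewrite mxE -mulrA.
Qed.

Definition efac s : {linear tensor -> tensor} := on_factor (sl2e F (m s)).
Definition ffac s : {linear tensor -> tensor} := on_factor (sl2f F (m s)).
Definition hfac s : {linear tensor -> tensor} := on_factor (sl2h F (m s)).

Lemma ffacC s l v : ffac s (ffac l v) = ffac l (ffac s v).
Proof. by have [->//|sl] := eqVneq s l; apply: on_factorC. Qed.

Lemma hfac_ffac s l v :
  hfac s (ffac l v) = ffac l (hfac s v) - (2 * (s == l)%:R) *: ffac l v.
Proof.
have [->|sl] := eqVneq s l; last first.
  by rewrite mulr0 scale0r subr0; apply: on_factorC.
rewrite mulr1 /= !on_factorM sl2_hf -scaleNr on_factorDmx; congr (_ + _).
by rewrite -scaleNr on_factorZmx.
Qed.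

Lemma efac_ffac s l v :
  efac s (ffac l v) = ffac l (efac s v) + (s == l)%:R *: hfac l v.
Proof.
have [->|sl] := eqVneq s l; last by rewrite scale0r addr0; apply: on_factorC.
by rewrite scale1r /= !on_factorM sl2_ef on_factorDmx.
Qed.

Definition highest : tensor := pure_tens (fun s => fv F (@ord0 (m s))).

Lemma on_factor_pure_eigen s (A : 'M[F]_((m s).+1)) (u : forall l, 'cV[F]_((m l).+1)) a :
  A *m u s = a *: u s -> on_factor (s := s) A (pure_tens u) = a *: pure_tens u :> tensor.
Proof.
move=> Au; rewrite on_factor_pure Au; apply/ffunP=> J; rewrite !ffunE.
rewrite (bigD1 s) //= dfwith_in mxE (bigD1 s (F := fun l => u l (J l) 0)) //=.
rewrite /GRing.scale /= mulrA; congr (_ * _); apply: eq_bigr => l ls.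
by rewrite dfwith_out // eq_sym.
Qed.

Lemma efac_highest s : efac s highest = 0.
Proof.
by rewrite /= (@on_factor_pure_eigen _ _ _ 0) ?scale0r // sl2e_fv0.
Qed.

Lemma hfac_highest s : hfac s highest = (m s)%:R *: highest.
Proof. by apply: on_factor_pure_eigen; rewrite sl2h_fv mulr0 subr0. Qed.

Lemma coord_hfac s v J :
  coord (hfac s v) J = ((m s)%:R - 2 * (J s)%:R) * coord v J.
Proof.
rewrite /= on_factorE (bigD1 (J s)) //= mxE eqxx big1 ?addr0 => [|i]; last first.
  by rewrite mxE eq_sym => /negPf->; rewrite mul0r.
congr (_ * coord v _); apply/ffunP=> r.
by have [<-|sr] := eqVneq s r; rewrite ?update_in ?update_out.
Qed.

(** Coordinates are read through a function [phi] of arbitrary natural multi-indices, since the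
    shifted index is not of type [tidx]; invariance of [phi] under pointwise equality is assumed to
    avoid functional extensionality. *)
Lemma coord_ffac (phi : ('I_n -> nat) -> F) s v J :
    (forall a b, a =1 b -> phi a = phi b) ->
    (forall I, coord v I = phi (fun l => I l)) ->
  coord (ffac s v) J =
    if (0 < J s)%N then phi (fun l => J l - (l == s))%N else 0.
Proof.
move=> phi_ext phiE; rewrite /= on_factorE.
case: posnP => [J0|J_gt0].
  by apply: big1 => i _; rewrite mxE J0 mul0r.
have lt_J : ((J s).-1 < (m s).+1)%N by rewrite (leq_ltn_trans (leq_pred _)).
rewrite (bigD1 (Ordinal lt_J)) //= mxE /= prednK // eqxx mul1r big1 ?addr0.
  rewrite phiE; apply: phi_ext => l; have [->|ls] := eqVneq l s.
    by rewrite update_in subn1.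
  by rewrite update_out ?subn0 // eq_sym.
move=> i neq_i; rewrite mxE; case: eqP => [Ji|]; last by rewrite mul0r.
by case/eqP: neq_i; apply: val_inj; rewrite /= Ji.
Qed.

Lemma coord_efac (phi : ('I_n -> nat) -> F) s v J :
    (forall a b, a =1 b -> phi a = phi b) ->
    (forall I, coord v I = phi (fun l => I l)) ->
  coord (efac s v) J =
    if (J s < m s)%N then
      (J s).+1%:R * ((m s)%:R - (J s)%:R) * phi (add1 (fun l => J l) s) else 0.
Proof.
move=> phi_ext phiE; rewrite /= on_factorE.
case: ltnP => [J_lt|J_ge]; last first.
  apply: big1 => i _; rewrite mxE; case: eqP => [iE|]; last by rewrite mul0r.
  by have := ltn_ord i; rewrite iE ltnS ltnNge J_ge.
rewrite (bigD1 (Ordinal (J_lt : (J s).+1 < (m s).+1)%N)) //= mxE eqxx big1 ?addr0.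
  rewrite phiE subnSK // natrM natrB 1?ltnW //; congr (_ * _).
  apply: phi_ext => l; rewrite /add1; have [->|ls] := eqVneq l s.
    by rewrite update_in addn1.
  by rewrite update_out ?addn0 // eq_sym.
move=> i neq_i; rewrite mxE; case: eqP => [iE|]; last by rewrite mul0r.
by case/eqP: neq_i; apply: val_inj.
Qed.

(** Applying f(t) chooses the factor s that receives t and lowers J_s by one, which is the recursion
    of [arrangement_sum]. *)
Lemma coord_bethe z ts J :
  coord (bethe ffac z highest ts) J = arrangement_sum z ts (fun s => J s).
Proof.
elim: ts J => [|t ts IH] J /=.
  rewrite ffunE; case: forallP => [J0|/forallP].
    rewrite big1 // => s _; rewrite mxE !andbT.
    by move/eqP: (J0 s) => /= J0s; rewrite (_ : J s == ord0) //; apply/eqP/val_inj.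
  rewrite negb_forall => /existsP[s Js]; rewrite (bigD1 s) //= mxE andbT.
  by rewrite -val_eqE /= (negPf Js) mul0r.
rewrite sum_ffunE [RHS]big_mkcond; apply: eq_bigr => s _.
rewrite ffunE (@coord_ffac (arrangement_sum z ts)) //; last exact: eq_arrangement_sum.
by case: ifP => _; rewrite ?scaler0.
Qed.

End TensorOperators.

(** Each entry of [ts] uses up one unit of J. Hence the Bethe vector is supported on |J| = k. *)
Lemma arrangement_sum_eq0 (F : fieldType) n (z : 'I_n -> F) ts (J : 'I_n -> nat) :
  \sum_s J s != size ts -> arrangement_sum z ts J = 0.
Proof.
elim: ts J => [|t ts IH] J /= sumJ.
  case: forallP => // J0; case/eqP: sumJ; apply: big1 => s _; exact/eqP.
apply: big1 => s J_gt0; rewrite IH ?mulr0 //.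
apply: contraNneq sumJ => sumJ'; apply/eqP; rewrite -sumJ' (bigD1 s) //=.
rewrite [in RHS](bigD1 s) //= eqxx subn1 -addSn prednK //; congr (_ + _)%N.
by apply: eq_bigr => l /negPf->; rewrite subn0.
Qed.

Lemma fact_pchar_neq0 (F : fieldType) p N : p \in [pchar F] -> (N < p)%N ->
  (N`!)%:R != 0 :> F.
Proof.
move=> charFp; rewrite -(dvdn_pcharf charFp).
elim: N => [|N IH] ltNp; first by rewrite gtnNdvd ?prime_gt1 ?(pcharf_prime charFp).
by rewrite factS Euclid_dvdM ?(pcharf_prime charFp) // gtnNdvd //= IH // ltnW.
Qed.

(** * The weight vector as an on-shell Bethe vector *)

Section BetheVector.
Variables (F : fieldType) (n k : nat) (m : 'I_n -> nat).
Variables (z : 'I_n -> F) (t : 'I_k -> F).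
Hypothesis fact_neq0 : forall J : 'I_n -> nat, (forall s, J s <= m s)%N ->
  (\prod_s (J s)`!)%:R != 0 :> F.

Let ts := [seq t i | i <- enum 'I_k].

Lemma weight_vec_bethe : weight_vec m t z = bethe (ffac F m) z (highest F m) ts.
Proof.
apply/ffunP=> J; rewrite coord_bethe sum_ffunE big_mkcond (bigD1 J) //=.
rewrite big1 ?addr0 => [|J' neqJ]; last first.
  by case: ifP => // _; rewrite ffunE fJvE eq_sym (negPf neqJ) scaler0.
have Jm s : (J s <= m s)%N by rewrite -ltnS ltn_ord.
rewrite /in_I; case: eqP => [sumJ|/eqP sumJ] /=; last first.
  by rewrite arrangement_sum_eq0 // size_map size_enum_ord.
case: forallP => // _; rewrite ffunE fJvE eqxx /GRing.scale /= mulr1.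
by rewrite weight_fun_arrangement_sum // fact_neq0.
Qed.

Lemma weight_fun0_arrangement_sum J : (\sum_s J s)%N = k ->
  weight_fun0 m t z J = if [forall s, J s <= m s]%N then arrangement_sum z ts J else 0.
Proof.
move=> sumJ; rewrite /weight_fun0 /in_I sumJ eqxx /=; case: forallP => // Jm.
by rewrite weight_fun_arrangement_sum // fact_neq0.
Qed.

Lemma weight_vec_weight :
  weight_vec m t z \in weight_space m ((\sum_s m s)%N%:Z - (2 * k)%N%:Z).
Proof.
rewrite inE weight_vec_bethe; apply/eqP/ffunP=> J; rewrite sum_ffunE ffunE.
rewrite (eq_bigr _ (fun s _ => coord_hfac s _ J)).
rewrite -mulr_suml coord_bethe.
have [sumJ|sumJ] := eqVneq (\sum_s J s)%N k; last first.
  by rewrite arrangement_sum_eq0 ?mulr0 ?scaler0 // size_map size_enum_ord.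
congr (_ * _); rewrite sumrB -mulr_sumr rmorphB /= -!pmulrn -!natr_sum sumJ.
by rewrite natrM.
Qed.

Hypothesis z_inj : injective z.
Hypothesis t_sol : Bethe_solution m z t.

Let uniq_ts : uniq ts.
Proof.
case: t_sol => tt _ _; rewrite map_inj_uniq ?enum_uniq // => i j eq_t.
by apply/eqP; apply: contraTT isT => /tt; rewrite eq_t subrr eqxx.
Qed.

Let ts_neq_z : {in ts, forall x s, x != z s}.
Proof.
by case: t_sol => _ tz _ _ /mapP[i _ ->] s; rewrite -subr_eq0.
Qed.

Let defect_eq0 : {in ts, forall x, defect z (fun s => (m s)%:R) ts x = 0}.
Proof.
case: t_sol => _ _ eqs _ /mapP[i _ ->]; apply: oppr_inj.
(* The defect sums over all entries, including t_i itself; that term is zero because the inverse of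
   0 is 0. *)
rewrite oppr0 opprB big_map big_enum /= (bigD1 i) //= subrr invr0 mulr0 add0r.
exact: eqs.
Qed.

Lemma efac_weight_vec : \sum_s efac F m s (weight_vec m t z) = 0.
Proof.
rewrite weight_vec_bethe.
rewrite (e_bethe (@ffacC F n m) (@hfac_ffac F n m) (@efac_ffac F n m)
  (@efac_highest F n m) (@hfac_highest F n m)) //.
exact: bethe_deriv_eq0.
Qed.

Lemma weight_vec_Sing :
  weight_vec m t z \in Sing m ((\sum_s m s)%N%:Z - (2 * k)%N%:Z).
Proof. by rewrite inE weight_vec_weight; apply/eqP/efac_weight_vec. Qed.

Lemma sing_relation J : (0 < k)%N -> in_I m k.-1 J ->
  \sum_s (J s).+1%:R * ((m s)%:R - (J s)%:R) * weight_fun0 m t z (add1 J s) = 0.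
Proof.
move=> k_gt0 /andP[/eqP sumJ /forallP Jm].
pose I : tidx m := finfun (fun s => Ordinal (Jm s : (J s < (m s).+1)%N)).
have IE s : I s = J s :> nat by rewrite ffunE.
have /ffunP/(_ I) := efac_weight_vec; rewrite sum_ffunE [RHS]ffunE; apply: etrans.
apply: eq_bigr => s _.
rewrite (@coord_efac _ _ _ (arrangement_sum z ts)); first last.
- by move=> J'; rewrite weight_vec_bethe coord_bethe.
- exact: eq_arrangement_sum.
rewrite IE (eq_arrangement_sum _ _ (J' := add1 J s)); last first.
  by move=> l; rewrite /add1 IE.
have sum_add1 : (\sum_l add1 J s l)%N = k.
  rewrite big_split /= sumJ (bigD1 s) //= eqxx big1 ?addn0 ?addn1 ?prednK //.
  by move=> l /negPf->.
rewrite weight_fun0_arrangement_sum //.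
case: ltnP => [J_lt|J_ge].
  case: forallP => // -[] l; rewrite /add1; have [->|_] := eqVneq l s.
    by rewrite addn1.
  by rewrite addn0 Jm.
(* When J_s = m_s, row J_s of e is zero and so is the coefficient m_s - J_s. *)
by rewrite (_ : J s = m s) ?subrr ?mulr0 ?mul0r //; apply/anti_leq; rewrite Jm.
Qed.

Lemma Gaudin_weight_vec s : (forall l, l != s -> 2 != 0 :> F) ->
  Gaudin z s (weight_vec m t z) = Gaudin_eigenvalue m t z s *: weight_vec m t z.
Proof.
move=> two_neq0; rewrite weight_vec_bethe.
rewrite -[LHS]/(hamiltonian (efac F m) (ffac F m) (hfac F m) z s _).
rewrite (hamiltonian_bethe (@ffacC F n m) (@hfac_ffac F n m) (@efac_ffac F n m)
  (@efac_highest F n m) (@hfac_highest F n m)) //.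
rewrite bethe_deriv_eq0 => [|x xts]; last by rewrite defect_eq0 // mul0r.
by rewrite linear0 subr0 /ts big_map big_enum.
Qed.

End BetheVector.
Theorem theorem2p3 (p k n : nat) (m : 'I_n -> nat)
    (z : 'I_n -> 'F_p) (t : 'I_k -> 'F_p) :
  prime p -> (0 < k)%N -> (0 < n)%N -> (forall s, (0 < m s)%N) ->
  (\sum_s m s < p)%N ->
  injective z ->
  Bethe_solution m z t ->
  [/\ forall J : 'I_n -> nat, in_I m k J -> weight_fun_defined t z J,
      weight_vec m t z \in Sing m ((\sum_s m s)%N%:Z - (2 * k)%N%:Z),
      forall J : 'I_n -> nat, in_I m k.-1 J ->
        \sum_s ((J s).+1)%:R * ((m s)%:R - (J s)%:R)
                 * weight_fun0 m t z (add1 J s) = 0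
    & forall s : 'I_n,
        Gaudin z s (weight_vec m t z)
        = Gaudin_eigenvalue m t z s *: weight_vec m t z].
Proof.
move=> p_pr k_gt0 _ m_gt0 lt_mp z_inj t_sol.
have lt_m s : (m s < p)%N.
  by apply: leq_ltn_trans lt_mp; rewrite (bigD1 s) //= leq_addr.
have fact_neq0 (J : 'I_n -> nat) : (forall s, J s <= m s)%N ->
    (\prod_s (J s)`!)%:R != 0 :> 'F_p.
  move=> Jm; rewrite natr_prod; apply/prodf_neq0 => s _.
  by rewrite (fact_pchar_neq0 (pchar_Fp p_pr)) // (leq_ltn_trans (Jm s)).
split.
- move=> J /andP[_ /forallP Jm]; split; first by rewrite -natr_prod fact_neq0.
  by case: t_sol => _ tz _ sigma s a _; apply: tz.
- exact: weight_vec_Sing.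
- by move=> J; apply: sing_relation.
- move=> s; apply: Gaudin_weight_vec => // l ls.
  (* Two distinct factors give p > m_s + m_l >= 2, so 2 is invertible. *)
  rewrite -(dvdn_pcharf (pchar_Fp p_pr)) gtnNdvd //.
  apply: leq_ltn_trans lt_mp; rewrite (bigD1 s) // (bigD1 l) //= addnA.
  by rewrite (leq_trans _ (leq_addr _ _)) // (leq_add (m_gt0 s) (m_gt0 l)).
Qed.
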